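(* Consider the inexact Rayleigh quotient iteration with MINRES for a Hermitian matrix $A$ described in the context, and assume that there is an angle $\varphi$, independent of $k$, with $|\cos\varphi_k|\ge|\cos\varphi|>0$ for all $k$, where $\varphi_k=\angle(f_k,(A-\theta_kI)e_k)$ (that is, $|\cos\varphi|$ is uniformly away from zero). Then the following hold asymptotically (for all $k$ with $\sin\phi_k$ sufficiently small). 1. (Cubic convergence) If $\xi_k\le\xi$ with a fixed constant $\xi<1$ (not near one), then $$\tan\phi_{k+1}\le\frac{2\beta(|\cos\varphi|+2\xi_k\beta)}{(1-\xi_k)|\cos\varphi|}\sin^3\phi_k.$$ 2. (Quadratic convergence) If $\xi_k$ is near one and bounded by $$\xi_k\le1-\frac{6\beta^2\sin\phi_k}{\eta|\cos\varphi|}$$ with $\eta$ a moderate constant, then $$\tan\phi_{k+1}\le\eta\sin^2\phi_k.$$ 3. (At least linear convergence) If, with a constant $\zeta<1$ independent of $k$, $\xi_k$ is bounded by $$1-\frac{6\beta^2\sin\phi_k}{\eta|\cos\varphi|}<\xi_k\le1-\frac{6\beta^2\sin^2\phi_k}{\zeta|\cos\varphi|},$$ then $$\tan\phi_{k+1}\le\zeta\sin\phi_k.$$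
   Context: Setting. $A\in\mathbb{C}^{n\times n}$ is Hermitian with eigenvalues $\lambda=\lambda_1,\lambda_2,\ldots,\lambda_n$ and corresponding orthonormal eigenvectors $x=x_1,x_2,\ldots,x_n$; $(\lambda,x)$ is the desired eigenpair. $\lambda_{\min},\lambda_{\max}$ are the smallest and largest eigenvalues of $A$, $\|\cdot\|$ is the Euclidean norm, and $$\beta=\frac{\lambda_{\max}-\lambda_{\min}}{|\lambda_2-\lambda|}.$$ Inexact Rayleigh quotient iteration (RQI) with MINRES: given a unit vector $u_k$, put $\theta_k=u_k^*Au_k$; apply $m>1$ steps of MINRES with zero initial guess to $(A-\theta_kI)w=u_k$, i.e. let $w_{k+1}$ minimize $\|(A-\theta_kI)w-u_k\|$ over $w$ in the Krylov subspace $\mathcal{K}_m(A,u_k)=\mathrm{span}\{u_k,Au_k,\ldots,A^{m-1}u_k\}$. Write $$(A-\theta_kI)w_{k+1}=u_k+\xi_kd_k,\qquad \|d_k\|=1,\ \xi_k>0,$$ where $\xi_k\le1$ is the (relative) residual norm and $d_k$ the residual direction; then set $u_{k+1}=w_{k+1}/\|w_{k+1}\|$. Standing assumption: $u_k$ is a reasonably good approximation to $x$ in the sense that, for every $k$ considered, $|\lambda-\theta_k|<|\lambda_2-\theta_k|\le\cdots\le|\lambda_n-\theta_k|$ and $|\lambda-\theta_k|<\tfrac12|\lambda-\lambda_2|$. Angles: $\phi_k=\angle(u_k,x)$ is the acute angle between $u_k$ and $x$, and $\psi_k=\angle(d_k,x)\in[0,\pi]$; one writes the orthogonal decompositions $u_k=x\cos\phi_k+e_k\sin\phi_k$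 with $e_k\perp x$, $\|e_k\|=1$, and $d_k=x\cos\psi_k+f_k\sin\psi_k$ with $f_k\perp x$, $\|f_k\|=1$ (the coefficients along $x$ being taken real). The angle $\varphi_k$ between $f_k$ and $(A-\theta_kI)e_k$ satisfies $|f_k^*(A-\theta_kI)e_k|=\|(A-\theta_kI)e_k\|\,|\cos\varphi_k|$. $\eta>0$ and $\zeta\in(0,1)$ are constants independent of $k$. *)

(* Defs.v *)
From HB Require Import structures.
From mathcomp Require Import all_boot all_order all_algebra.
From mathcomp Require Import spectral complex.
From mathcomp Require Import reals trigo.

Set Implicit Arguments.
Unset Strict Implicit.
Unset Printing Implicit Defensive.

Import Order.TTheory GRing.Theory Num.Theory.
Local Open Scope ring_scope.
Local Open Scope complex_scope.
Local Open Scope sesquilinear_scope.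

Section Geometry.
Context {R : realType} {n : nat}.
Implicit Types (u v : 'cV[R[i]]_n).

Definition cmod (z : R[i]) : R := complex.Re `|z|.

(* [cdot u v] is u^* v, hence conjugate-linear in u. *)
Definition cdot u v : R[i] := (u ^t* *m v) 0 0.

Definition cnorm v : R := Num.sqrt (complex.Re (cdot v v)).

Definition acute_angle u v : R := acos (cmod (cdot u v) / (cnorm u * cnorm v)).

(* The angle in [0, pi] between vectors whose inner product is real. *)
Definition angle u v : R :=
  acos (complex.Re (cdot u v) / (cnorm u * cnorm v)).

End Geometry.

Section RayleighQuotientIteration.
(* The dimension is n.+2, since a second eigenvalue has to exist. *)
Context {R : realType} {n : nat}.
Implicit Types (A : 'M[R[i]]_n.+2) (u w d e f : 'cV[R[i]]_n.+2).
Implicit Types (lam : 'I_n.+2 -> R) (x : 'I_n.+2 -> 'cV[R[i]]_n.+2).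

Definition idx1 : 'I_n.+2 := ord0.
Definition idx2 : 'I_n.+2 := lift ord0 ord0.

Record orthonormal_eigensystem A lam x : Prop := OrthonormalEigensystem {
  eigen_pair : forall i, A *m x i = (lam i)%:C *: x i;
  eigen_orthonormal : forall i j, cdot (x i) (x j) = (i == j)%:R }.

Definition lam_max lam : R := \big[Num.max/lam ord0]_i lam i.
Definition lam_min lam : R := \big[Num.min/lam ord0]_i lam i.

Definition beta lam : R := (lam_max lam - lam_min lam) / `|lam idx2 - lam idx1|.

(* For Hermitian A the number u^* A u is real, and Re only changes its type. *)
Definition rayleigh A u : R := complex.Re (cdot u (A *m u)).

Definition shifted A (theta : R) : 'M[R[i]]_n.+2 := A - theta%:C%:M.

Definition krylov m A u : {vspace 'cV[R[i]]_n.+2} :=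
  <<[seq A ^+ i *m u | i <- iota 0 m]>>%VS.

Definition minres_iterate m A u w : Prop :=
  let residual v := cnorm (shifted A (rayleigh A u) *m v - u) in
  w \in krylov m A u /\
  forall v, v \in krylov m A u -> residual w <= residual v.

(* w <> 0 is what makes the normalisation defining the next iterate legitimate;
   cnorm d = 1 makes xi the residual norm, so xi <= 1 follows from comparing
   with the zero initial guess. *)
Record rqi_minres_step m A u w (xi : R) d u' : Prop := RqiMinresStep {
  step_unit : cnorm u = 1;
  step_minres : minres_iterate m A u w;
  step_residual : shifted A (rayleigh A u) *m w = u + xi%:C *: d;
  step_direction : cnorm d = 1;
  step_xi_gt0 : 0 < xi;
  step_neq0 : w != 0;
  step_next : u' = (cnorm w)^-1%:C *: w }.

Record good_approximation lam (theta : R) : Prop := GoodApproximation {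
  approx_lt : `|lam idx1 - theta| < `|lam idx2 - theta|;
  approx_le : forall i j : 'I_n.+2, (0 < i <= j)%N ->
    `|lam i - theta| <= `|lam j - theta|;
  approx_half : `|lam idx1 - theta| < 2^-1 * `|lam idx1 - lam idx2| }.

(* An eigenvector is determined up to a unit scalar only. The scalar s is the
   normalisation, at the given step, for which s *: x1 has real inner products
   with both u and d. It always exists: u fixes it, and d inherits it, since
   d is a real polynomial in A applied to u. It has to be allowed to change
   from one step to the next, because the acute angle forces a nonnegative
   coefficient of u on s *: x1, whereas the iteration may change its sign. The
   vectors e and f do not depend on s. *)
Record angle_decomposition (x1 : 'cV[R[i]]_n.+2) u d (s : R[i]) e f : Prop :=
  AngleDecomposition {
  decomp_phase : cmod s = 1;
  decomp_u : u = (cos (acute_angle u x1))%:C *: (s *: x1)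
                 + (sin (acute_angle u x1))%:C *: e;
  decomp_e_orth : cdot x1 e = 0;
  decomp_e_unit : cnorm e = 1;
  decomp_d : d = (cos (angle d (s *: x1)))%:C *: (s *: x1)
                 + (sin (angle d (s *: x1)))%:C *: f;
  decomp_f_orth : cdot x1 f = 0;
  decomp_f_unit : cnorm f = 1 }.

(* [varphi] is an angle between f and (A - theta I) e, where theta is the
   Rayleigh quotient of u. *)
Definition is_angle_f_Ae A u e f (varphi : R) : Prop :=
  let Ae := shifted A (rayleigh A u) *m e in
  cmod (cdot f Ae) = cnorm Ae * `|cos varphi|.

(* [K] selects the steps considered: [predT] for an infinite run, the first N
   indices for a run stopped after N steps. *)
Record inexact_rqi_minres (m : nat) A lam x (K : pred nat)
    (u w d e f : nat -> 'cV[R[i]]_n.+2) (s : nat -> R[i])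
    (xi varphi : nat -> R) : Prop := InexactRqiMinres {
  run_step : forall k, K k ->
    rqi_minres_step m A (u k) (w k.+1) (xi k) (d k) (u k.+1);
  run_approx : forall k, K k -> good_approximation lam (rayleigh A (u k));
  run_decomp : forall k, K k ->
    angle_decomposition (x idx1) (u k) (d k) (s k) (e k) (f k);
  run_varphi : forall k, K k ->
    is_angle_f_Ae A (u k) (e k) (f k) (varphi k) }.

(* The tangent of an acute angle is infinite at pi/2, but [tan (pi / 2)] is the
   junk value 0, hence the first conjunct. *)
Definition acute_tan_le (t b : R) : Prop := t < pi / 2 /\ tan t <= b.

End RayleighQuotientIteration.

(* Main.v *)
Require Import Defs.
From HB Require Import structures.
From mathcomp Require Import all_boot all_order all_algebra.
From mathcomp Require Import spectral complex.
From mathcomp Require Import reals trigo.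
From mathcomp Require Import ring lra.

Set Implicit Arguments.
Unset Strict Implicit.
Unset Printing Implicit Defensive.

Import Order.TTheory GRing.Theory Num.Theory.
Local Open Scope complex_scope.
Local Open Scope ring_scope.

(** Split everything along the desired eigenvector x and its orthogonal
complement, and write B = A - theta I. The component of w along x is the
coefficient of u + xi d along x divided by lambda - theta, whereas B stretches
the complement of x by at least |lambda_2 - theta|. With w = (x^* w) x + w' this
gives
  |lambda - theta| |x^* w| = |cos phi + xi cos psi|,
  |lambda_2 - theta| |w'| <= sin phi + xi sin psi,
and the tangent of the next angle is |w'| / |x^* w|.

Three powers of sin phi come out of this quotient. Two of them are the
quadratic accuracy of the Rayleigh quotient: theta - lambda is an average of the
differences lambda_i - lambda weighted by |x_i^* u|^2, so that
|lambda - theta| <= beta |lambda_2 - lambda| sin^2 phi ([rayleigh_quadratic]).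
The third one is the numerator, because sin psi is itself O(sin phi). This is
where the minimal residual property enters: u belongs to the Krylov space, so
the residual xi d is orthogonal to B u. As B preserves the splitting,
  |lambda - theta| cos phi |cos psi| = sin phi sin psi |f^* B e|
([residual_direction_orth]), and |f^* B e| >= |lambda_2 - theta| |cos varphi|
stays away from zero.

The denominator cos phi + xi cos psi is at least (1 - xi) - sin^2 phi. It is
comparable with 1 - xi as soon as sin^2 phi is small with respect to 1 - xi,
which each of the three assumptions on xi guarantees near x; the cubic bound
([rqi_step_cubic]) therefore holds in all three cases, and the quadratic and
linear bounds are what it becomes when 1 - xi is bounded below by a multiple of
sin phi or of sin^2 phi ([cubic_bound_le]).

When sin phi = 0 the assumption of the quadratic case only says xi <= 1, and the
division by 1 - xi is meaningless. Then u is an eigenvector, so is every nonzero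
element of its Krylov space, and the next angle is zero ([rqi_step_of_eigenvector]). *)

(** * Hermitian products *)

Section HermitianProduct.
Context {R : realType}.
Implicit Types (z : R[i]) (r : R).

Lemma cmodE z : (cmod z)%:C = `|z|.
Proof. by rewrite RRe_real ?normr_real. Qed.

Lemma cmod_ge0 z : 0 <= cmod z.
Proof. by rewrite -ler0c cmodE. Qed.

Lemma cmodM z1 z2 : cmod (z1 * z2) = cmod z1 * cmod z2.
Proof. by apply: complexI; rewrite rmorphM !cmodE normrM. Qed.

Lemma cmod_conj z : cmod z^* = cmod z.
Proof. by rewrite /cmod norm_conjC. Qed.

Lemma cmod_real r : cmod r%:C = `|r|.
Proof. by rewrite /cmod normc_def /= expr0n /= addr0 sqrtr_sqr. Qed.

Lemma cmod_eq0 z : (cmod z == 0) = (z == 0).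
Proof. by rewrite -(inj_eq (@complexI R)) cmodE normr_eq0. Qed.

Lemma conj_realC r : (r%:C)^* = r%:C.
Proof. by rewrite conj_Creal // complex_real. Qed.

Lemma Re_realM r z : complex.Re (r%:C * z) = r * complex.Re z.
Proof. by case: z => a b /=; rewrite mul0r subr0. Qed.

Lemma ReN z : complex.Re (- z) = - complex.Re z.
Proof. by case: z. Qed.

Lemma ReD z1 z2 : complex.Re (z1 + z2) = complex.Re z1 + complex.Re z2.
Proof. by case: z1; case: z2. Qed.

Lemma Re_conj z : complex.Re z^* = complex.Re z.
Proof. by case: z. Qed.

Context {n : nat}.
Implicit Types (u v w : 'cV[R[i]]_n) (a : R[i]).

Lemma cdotE u v : cdot u v = \sum_j (u j 0)^* * v j 0.
Proof. by rewrite /cdot mxE; apply: eq_bigr => j _; rewrite !mxE. Qed.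

Lemma cdotDr u v w : cdot u (v + w) = cdot u v + cdot u w.
Proof. by rewrite /cdot mulmxDr mxE. Qed.

Lemma cdotNr u v : cdot u (- v) = - cdot u v.
Proof. by rewrite /cdot mulmxN mxE. Qed.

Lemma cdotZr a u v : cdot u (a *: v) = a * cdot u v.
Proof. by rewrite /cdot -scalemxAr mxE. Qed.

Lemma cdot_conj u v : (cdot u v)^* = cdot v u.
Proof.
rewrite !cdotE rmorph_sum; apply: eq_bigr => j _.
by rewrite rmorphM /= conjCK mulrC.
Qed.

Lemma cdotDl u v w : cdot (v + w) u = cdot v u + cdot w u.
Proof. by rewrite -cdot_conj cdotDr rmorphD /= !cdot_conj. Qed.

Lemma cdotNl u v : cdot (- v) u = - cdot v u.
Proof. by rewrite -cdot_conj cdotNr rmorphN /= cdot_conj. Qed.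

Lemma cdotZl a u v : cdot (a *: v) u = a^* * cdot v u.
Proof. by rewrite -cdot_conj cdotZr rmorphM /= cdot_conj. Qed.

Lemma cdot_sum_sqr v : cdot v v = (\sum_j cmod (v j 0) ^+ 2)%:C.
Proof.
rewrite cdotE rmorph_sum; apply: eq_bigr => j _.
by rewrite rmorphXn /= cmodE normCK mulrC.
Qed.

Lemma cnorm_sqr v : cnorm v ^+ 2 = complex.Re (cdot v v).
Proof.
rewrite sqr_sqrtr // cdot_sum_sqr /= sumr_ge0 // => j _.
exact: sqr_ge0.
Qed.

Lemma cdot_self v : cdot v v = (cnorm v ^+ 2)%:C.
Proof. by rewrite cnorm_sqr cdot_sum_sqr. Qed.

Lemma cnorm_ge0 v : 0 <= cnorm v.
Proof. exact: sqrtr_ge0. Qed.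

Lemma cnormZ a v : cnorm (a *: v) = cmod a * cnorm v.
Proof.
apply/eqP; rewrite -(eqrXn2 (n := 2)) ?cnorm_ge0 //; last first.
  by rewrite mulr_ge0 ?cnorm_ge0 ?cmod_ge0.
apply/eqP/complexI.
rewrite -cdot_self cdotZl cdotZr cdot_self exprMn [RHS]rmorphM mulrA.
by congr (_ * _); rewrite rmorphXn /= cmodE normCK mulrC.
Qed.

Lemma cnorm_eq0 v : (cnorm v == 0) = (v == 0).
Proof.
apply/eqP/eqP => [v0|->]; last first.
  by rewrite -(scale0r 0) cnormZ (eqP (_ : cmod 0 == 0)) ?mul0r // cmod_eq0.
have : \sum_j cmod (v j 0) ^+ 2 = 0.
  by apply: complexI; rewrite -cdot_sum_sqr cdot_self v0 expr0n.
move/eqP; rewrite psumr_eq0 => [/allP all0|j _]; last exact: sqr_ge0.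
apply/matrixP => j k; rewrite ord1 mxE; apply/eqP.
by rewrite -cmod_eq0 -sqrf_eq0; apply: all0; rewrite mem_index_enum.
Qed.

(** The normalised case of the Cauchy-Schwarz inequality, from |u - v|^2 >= 0. *)
Lemma Re_cdot_le1 u v : cnorm u = 1 -> cnorm v = 1 -> complex.Re (cdot u v) <= 1.
Proof.
move=> u1 v1; have := sqr_ge0 (cnorm (u - v)).
rewrite cnorm_sqr cdotDl !cdotDr !cdotNl !cdotNr !cdot_self u1 v1 -[cdot v u]cdot_conj.
by rewrite !ReD !ReN Re_conj /=; lra.
Qed.

Lemma cnorm_unit_comb_le u v (a b : R) : cnorm u = 1 -> cnorm v = 1 ->
  0 <= a -> 0 <= b -> cnorm (a%:C *: u + b%:C *: v) <= a + b.
Proof.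
move=> u1 v1 a0 b0; rewrite -ler_sqr ?nnegrE ?cnorm_ge0 ?addr_ge0 //.
rewrite cnorm_sqr cdotDl !cdotDr !cdotZl !cdotZr !cdot_self u1 v1 !conj_realC.
rewrite -[cdot v u]cdot_conj !ReD !Re_realM Re_conj /=.
have := Re_cdot_le1 u1 v1; have := mulr_ge0 a0 b0; nra.
Qed.

(** The first-order condition of a complex least-squares problem, obtained from
the single competitor a = - (u^* v) / (1 + |u|^2): the denominator 1 + |u|^2
instead of |u|^2 avoids a separate case for u = 0. *)
Lemma shortest_orth u v : (forall a, cnorm v <= cnorm (v + a *: u)) -> cdot u v = 0.
Proof.
move=> v_min; pose g := cdot u v; pose N := cnorm u ^+ 2.
have N0 : 0 <= N := sqr_ge0 _.
pose k := - (1 + N)^-1; pose G := cmod g ^+ 2.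
have kgC : (k%:C * g)^* = k%:C * g^*.
  by rewrite [LHS]rmorphM; congr (_ * _); exact: conj_realC.
have ggC : g * g^* = G%:C by rewrite rmorphXn /= cmodE normCK.
have := v_min (k%:C * g).
rewrite -ler_sqr ?nnegrE ?cnorm_ge0 // [X in _ <= X]cnorm_sqr.
have -> : cdot (v + (k%:C * g) *: u) (v + (k%:C * g) *: u) =
    (cnorm v ^+ 2 + 2 * k * G + k ^+ 2 * N * G)%:C.
  rewrite cdotDl !cdotDr !cdotZl !cdotZr -[cdot v u]cdot_conj -/g !cdot_self -/N kgC.
  transitivity ((cnorm v ^+ 2)%:C + 2 * k%:C * (g * g^*) + k%:C ^+ 2 * N%:C * (g * g^*)).
    by ring.
  by rewrite ggC; ring.
move=> /= Vle; suff G0 : G = 0 by apply/eqP; rewrite -cmod_eq0 -sqrf_eq0 -/g -/G G0.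
have kN : k * (1 + N) = - 1 by rewrite mulNr mulVf // gt_eqF // ltr_wpDr.
have k0 : k < 0 by rewrite oppr_lt0 invr_gt0 ltr_wpDr.
have : 0 <= G := sqr_ge0 _.
have : 0 <= k * G * (2 + k * N) by lra.
have -> : 2 + k * N = 1 - k by lra.
nra.
Qed.

(** The square matrix Q with columns x_i satisfies Q^* Q = 1, hence Q Q^* = 1. *)
Lemma parseval (x : 'I_n -> 'cV[R[i]]_n) u v :
  (forall i j, cdot (x i) (x j) = (i == j)%:R) ->
  cdot u v = \sum_i (cdot (x i) u)^* * cdot (x i) v.
Proof.
move=> x_on; pose Q := \matrix_(i, j) x j i 0 : 'M[R[i]]_n.
have QQ : (Q ^t*)%sesqui *m Q = 1%:M.
  apply/matrixP => i j; rewrite !mxE -x_on cdotE; apply: eq_bigr => k _.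
  by rewrite !mxE.
have cE i v' : cdot (x i) v' = ((Q ^t*)%sesqui *m v') i 0.
  by rewrite cdotE mxE; apply: eq_bigr => k _; rewrite !mxE.
under eq_bigr do rewrite !cE.
rewrite -cdotE /cdot trmx_mul map_mxM /= trmxCK -mulmxA.
by rewrite (mulmxA Q) (mulmx1C QQ) mul1mx.
Qed.

End HermitianProduct.

(** * Spectral coordinates *)

Section Eigensystem.
Context {R : realType} {n : nat}.
Variables (A : 'M[R[i]]_n.+2) (lam : 'I_n.+2 -> R) (x : 'I_n.+2 -> 'cV[R[i]]_n.+2).
Hypotheses (A_herm : A \is hermsymmx) (Alx : orthonormal_eigensystem A lam x).
Implicit Types (u v w : 'cV[R[i]]_n.+2) (theta : R).

Let x_on := eigen_orthonormal Alx.

Lemma cnorm_eigenvector i : cnorm (x i) = 1.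
Proof. by rewrite /cnorm x_on eqxx /= sqrtr1. Qed.

Lemma cnorm_sqr_coord v : cnorm v ^+ 2 = \sum_i cmod (cdot (x i) v) ^+ 2.
Proof.
apply: complexI; rewrite -cdot_self (parseval _ _ x_on) rmorph_sum.
by apply: eq_bigr => i _; rewrite rmorphXn /= cmodE normCK mulrC.
Qed.

Lemma cdot_herm u v : cdot u (A *m v) = cdot (A *m u) v.
Proof.
rewrite /cdot trmx_mul map_mxM -mulmxA.
by have /is_hermitianmxP := A_herm; rewrite expr0 scale1r => <-.
Qed.

Lemma coord_shifted i theta v :
  cdot (x i) (shifted A theta *m v) = (lam i - theta)%:C * cdot (x i) v.
Proof.
rewrite mulmxBl mul_scalar_mx cdotDr cdotNr cdotZr cdot_herm (eigen_pair Alx).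
by rewrite cdotZl conj_realC -mulrBl -rmorphB.
Qed.

Lemma rayleigh_coord u : rayleigh A u = \sum_i lam i * cmod (cdot (x i) u) ^+ 2.
Proof.
suff -> : rayleigh A u = complex.Re (\sum_i lam i * cmod (cdot (x i) u) ^+ 2)%:C.
  by [].
congr complex.Re; rewrite (parseval _ _ x_on) [RHS]rmorph_sum.
apply: eq_bigr => i _; rewrite cdot_herm (eigen_pair Alx) cdotZl conj_realC.
by rewrite [RHS]rmorphM [X in _ = _ * X]rmorphXn /= cmodE normCK; ring.
Qed.

Lemma lam_in_range i : lam_min lam <= lam i <= lam_max lam.
Proof. by rewrite bigmin_le_cond ?le_bigmax. Qed.

(** Both terms are averages with the weights |x_i^* u|^2, which sum to 1; the
difference has no contribution from x itself, and the remaining weight is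
1 - |x^* u|^2. *)
Lemma rayleigh_error u : cnorm u = 1 ->
  `|lam idx1 - rayleigh A u| <=
    (lam_max lam - lam_min lam) * (1 - cmod (cdot (x idx1) u) ^+ 2).
Proof.
move=> u1; have := cnorm_sqr_coord u; rewrite u1 expr1n => sum1.
rewrite -[lam _]mulr1 !sum1 rayleigh_coord mulr_sumr -sumrB.
rewrite !(bigD1 idx1 (P := xpredT)) //= subrr add0r addrAC subrr add0r.
rewrite mulr_sumr (le_trans (ler_norm_sum _ _ _)) // ler_sum // => i _.
rewrite -mulrBl normrM (ger0_norm (sqr_ge0 _)) ler_wpM2r ?sqr_ge0 //.
have /andP[? ?] := lam_in_range i; have /andP[? ?] := lam_in_range idx1.
by rewrite ler_norml; apply/andP; split; lra.
Qed.

(** In spectral coordinates the shifted matrix is diagonal, and v has no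
coordinate along the one eigenvector whose stretching may be smaller than M. *)
Lemma shifted_lower_bound theta M v : 0 <= M ->
  (forall i, i != idx1 -> M <= `|lam i - theta|) -> cdot (x idx1) v = 0 ->
  M * cnorm v <= cnorm (shifted A theta *m v).
Proof.
move=> M0 Mle xv; rewrite -ler_sqr ?nnegrE ?mulr_ge0 ?cnorm_ge0 //.
rewrite exprMn !cnorm_sqr_coord mulr_sumr ler_sum // => i _.
rewrite coord_shifted cmodM cmod_real exprMn.
have [->|/Mle Mi] := eqVneq i idx1.
  by rewrite xv (eqP (_ : cmod 0 == 0)) ?cmod_eq0 // expr0n !mulr0.
by rewrite ler_wpM2r ?sqr_ge0 // ler_sqr ?nnegrE.
Qed.

Definition orth_part v := v - cdot (x idx1) v *: x idx1.

Lemma cdot_orth_part v : cdot (x idx1) (orth_part v) = 0.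
Proof. by rewrite cdotDr cdotNr cdotZr x_on eqxx mulr1 subrr. Qed.

Lemma pythagoras v :
  cnorm v ^+ 2 = cmod (cdot (x idx1) v) ^+ 2 + cnorm (orth_part v) ^+ 2.
Proof.
rewrite !cnorm_sqr_coord !(bigD1 idx1 (P := xpredT)) //= cdot_orth_part.
rewrite (eqP (_ : cmod 0 == 0)) ?cmod_eq0 // expr0n add0r; congr (_ + _).
apply: eq_bigr => i i1; rewrite /orth_part cdotDr cdotNr cdotZr x_on.
by rewrite (negPf i1) mulr0 subr0.
Qed.

Lemma bessel v : cmod (cdot (x idx1) v) <= cnorm v.
Proof.
rewrite -ler_sqr ?nnegrE ?cmod_ge0 ?cnorm_ge0 // pythagoras.
by rewrite lerDl sqr_ge0.
Qed.

(** * Angles with the desired eigenvector *)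

Let acute_cos_in01 v :
  0 <= cmod (cdot v (x idx1)) / (cnorm v * cnorm (x idx1)) <= 1.
Proof.
rewrite cnorm_eigenvector mulr1 -cmod_conj cdot_conj.
rewrite divr_ge0 ?cmod_ge0 ?cnorm_ge0 //=.
have [->|v0] := eqVneq (cnorm v) 0; first by rewrite invr0 mulr0.
by rewrite ler_pdivrMr ?mul1r ?bessel // lt0r v0 cnorm_ge0.
Qed.

Lemma acute_angle_in0pi v : acute_angle v (x idx1) \in `[0, pi].
Proof.
have /andP[y0 y1] := acute_cos_in01 v.
have yB := conj (le_trans (lerN10 _) y0) y1.
by rewrite in_itv /= acos_ge0 ?acos_lepi //; apply/andP.
Qed.

Lemma cos_acute_angle v :
  cos (acute_angle v (x idx1)) = cmod (cdot (x idx1) v) / cnorm v.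
Proof.
have /andP[y0 y1] := acute_cos_in01 v.
rewrite acosK ?in_itv /= ?(le_trans (lerN10 _) y0) //.
by rewrite cnorm_eigenvector mulr1 -cmod_conj cdot_conj.
Qed.

Lemma sin_acute_angle_ge0 v : 0 <= sin (acute_angle v (x idx1)).
Proof. by rewrite sin_ge0_pi //; have := acute_angle_in0pi v; rewrite in_itv. Qed.

Lemma acute_angle_scale (r : R) v : 0 < r ->
  acute_angle (r%:C *: v) (x idx1) = acute_angle v (x idx1).
Proof.
move=> r0; rewrite /acute_angle cdotZl cmodM cmod_conj cnormZ cmod_real gtr0_norm //.
by congr acos; rewrite -(mulrA r (cnorm v)) -mulf_div divff ?mul1r // gt_eqF.
Qed.

(** The tangent is the quotient of the orthogonal component by the component
along x; a nonzero component along x excludes the angle pi / 2. *)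
Lemma acute_tan_le_orth v b : cdot (x idx1) v != 0 ->
  cnorm (orth_part v) <= b * cmod (cdot (x idx1) v) ->
  acute_tan_le (acute_angle v (x idx1)) b.
Proof.
rewrite -cmod_eq0 => a_neq0 Sb.
have a_gt0 : 0 < cmod (cdot (x idx1) v) by rewrite lt0r a_neq0 cmod_ge0.
have P_gt0 : 0 < cnorm v := lt_le_trans a_gt0 (bessel v).
have cos_gt0 : 0 < cos (acute_angle v (x idx1)).
  by rewrite cos_acute_angle divr_gt0.
split.
  rewrite -ltr_cos ?acute_angle_in0pi ?cos_pihalf // in_itv /=.
  by rewrite divr_ge0 ?pi_ge0 //= ler_pdivrMr // ler_peMr ?pi_ge0 ?ler1n.
have sinE : sin (acute_angle v (x idx1)) * cnorm v = cnorm (orth_part v).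
  apply/eqP; rewrite -(eqrXn2 (n := 2)) ?cnorm_ge0 //; last first.
    by rewrite mulr_ge0 ?sin_acute_angle_ge0 ?cnorm_ge0.
  apply/eqP; rewrite exprMn sin2cos2 cos_acute_angle mulrBl mul1r -exprMn.
  rewrite divfK ?lt0r_neq0 //.
  by rewrite pythagoras addrC addKr.
rewrite /tan ler_pdivrMr // -(ler_pM2r P_gt0) sinE cos_acute_angle.
by rewrite -mulrA divfK ?gt_eqF.
Qed.

(** * Minimal residuals *)

Lemma mem_krylov m u : (0 < m)%N -> u \in krylov m A u.
Proof.
by case: m => // m _; rewrite memv_span //= expr0 mul1mx mem_head.
Qed.

(** Moving w along u stays in the Krylov space and moves the residual along B u,
so the residual is shortest on that line. *)
Lemma minres_residual_orth m u w : (0 < m)%N -> minres_iterate m A u w ->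
  cdot (shifted A (rayleigh A u) *m u) (shifted A (rayleigh A u) *m w - u) = 0.
Proof.
move=> m0 [wK w_min]; apply: shortest_orth => a.
apply: le_trans (w_min (w + a *: u) _) _.
  by rewrite memvD // memvZ // mem_krylov.
by rewrite mulmxDr -scalemxAr addrAC.
Qed.

End Eigensystem.

(** * One step of the iteration *)

(** In the application L = |lambda - theta|, M = |lambda_2 - theta|,
G = |lambda_2 - lambda|, the numbers a and S are the sizes of the components of w
along and across x, and C, t, cp, sp are the cosine and sine of phi and of psi.

The last two hypotheses are chosen so that the constants multiply to the
required 2. The first one gives L <= G / 4, hence M >= 3 G / 4 and
L / M <= (4 / 3) b t^2; the second one gives
C + xi cp >= (1 - xi) - t^2 >= (2 / 3) (1 - xi); and (4 / 3) / (2 / 3) = 2. The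
estimate of sp loses 4 / 3 where the conclusion allows 2. *)
Lemma tangent_estimate (R : realFieldType) (b c xi t C sp cp a S L M G : R) :
  0 <= b -> 0 < c -> 0 < xi -> 0 < t -> 0 < G -> 0 <= sp -> 0 <= S -> 0 <= L ->
  C <= 1 -> 1 - t ^+ 2 <= C -> `|cp| <= 1 ->
  L <= b * G * t ^+ 2 -> G - L <= M ->
  M * S <= t + xi * sp -> L * a = `|C + xi * cp| ->
  t * sp * (M * c) <= L ->
  b * t ^+ 2 <= 1 / 4 -> 3 * t ^+ 2 <= 1 - xi ->
  0 < a /\ S <= 2 * b * (c + 2 * xi * b) / ((1 - xi) * c) * t ^+ 3 * a.
Proof.
move=> b0 c0 xi0 t0 G0 sp0 S0 L0 C1 Ct cp1 Lle ML MS La spc bt txi.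
have t2 : 0 < t ^+ 2 by rewrite exprn_gt0.
have xi1 : 0 < 1 - xi by lra.
have LG : L <= G / 4 by nra.
have M0 : 0 < M by lra.
have LM : 3 * L <= 4 * b * t ^+ 2 * M by have := mulr_ge0 b0 (ltW t2); nra.
(* The worst case is cp = - 1. *)
have den : 2 * (1 - xi) <= 3 * (L * a).
  rewrite La; have := ler_norm (C + xi * cp).
  by move: cp1; rewrite ler_norml => /andP[cp1 _]; nra.
have a0 : 0 < a.
  have La0 : 0 < L * a by lra.
  by rewrite ltNge; apply/negP => a0; nra.
split=> //.
(* The orthogonality relation, after cancelling t and M. *)
have spb : 3 * c * sp <= 4 * b * t.
  have : t * (M * (3 * c * sp)) <= t * (M * (4 * b * t)) by lra.
  by rewrite ler_pM2l // ler_pM2l.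
have num : c * (M * S) <= t * (c + 2 * xi * b).
  have : 0 <= b * t * xi by rewrite !mulr_ge0 // ltW.
  nra.
have Ma : 1 - xi <= 2 * b * t ^+ 2 * M * a by nra.
rewrite -(ler_pM2l (mulr_gt0 (mulr_gt0 xi1 c0) M0)).
have -> : (1 - xi) * c * M *
    (2 * b * (c + 2 * xi * b) / ((1 - xi) * c) * t ^+ 3 * a) =
    (2 * b * t ^+ 2 * M * a) * (t * (c + 2 * xi * b)).
  by field; rewrite ?lt0r_neq0.
have -> : (1 - xi) * c * M * S = (1 - xi) * (c * (M * S)) by ring.
by rewrite ler_pM ?mulr_ge0 // ltW.
Qed.

Section OneStep.
Context {R : realType} {n : nat}.
Variables (A : 'M[R[i]]_n.+2) (lam : 'I_n.+2 -> R) (x : 'I_n.+2 -> 'cV[R[i]]_n.+2).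
Hypotheses (A_herm : A \is hermsymmx) (Alx : orthonormal_eigensystem A lam x).
Variables (m : nat) (u w d u' e f : 'cV[R[i]]_n.+2) (s : R[i]) (xi varphi c : R).
Hypotheses (m_gt0 : (0 < m)%N) (step : rqi_minres_step m A u w xi d u').
Hypothesis dec : angle_decomposition (x idx1) u d s e f.

Let theta := rayleigh A u.
Let B := shifted A theta.
Let C := cos (acute_angle u (x idx1)).
Let t := sin (acute_angle u (x idx1)).
Let cp := cos (angle d (s *: x idx1)).
Let sp := sin (angle d (s *: x idx1)).
Let b := beta lam.
Let x_on := eigen_orthonormal Alx.

Let uE : u = C%:C *: (s *: x idx1) + t%:C *: e := decomp_u dec.
Let dE : d = cp%:C *: (s *: x idx1) + sp%:C *: f := decomp_d dec.
Let u1 : cnorm u = 1 := step_unit step.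

Lemma shifted_eigenvector i : B *m x i = (lam i - theta)%:C *: x i.
Proof.
by rewrite mulmxBl mul_scalar_mx (eigen_pair Alx) -scalerBl -rmorphB.
Qed.

Let sx1 : cnorm (s *: x idx1) = 1.
Proof. by rewrite cnormZ (decomp_phase dec) (cnorm_eigenvector Alx) mulr1. Qed.

(** The angle is an [acos] value, hence in [0, pi] once its argument is known to
lie in [-1, 1]. *)
Lemma sin_angle_d_ge0 : 0 <= sp.
Proof.
have /andP[] : -1 <= complex.Re (cdot d (s *: x idx1)) <= 1.
  rewrite (Re_cdot_le1 (step_direction step) sx1) andbT lerNl -ReN -cdotNl.
  rewrite Re_cdot_le1 //.
  by rewrite -scaleN1r cnormZ (step_direction step) /cmod normrN normr1 mulr1.
move=> y1 y2; rewrite sin_ge0_pi // /angle (step_direction step) sx1 mulr1 divr1.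
by rewrite acos_ge0 ?acos_lepi //; apply/andP.
Qed.

Lemma residual_expansion :
  B *m w = (C + xi * cp)%:C *: (s *: x idx1) + (t%:C *: e + (xi * sp)%:C *: f).
Proof.
rewrite (step_residual step) {1}uE dE.
have -> : (C + xi * cp)%:C = C%:C + xi%:C * cp%:C by ring.
have -> : (xi * sp)%:C = xi%:C * sp%:C by ring.
by rewrite scalerDr !scalerA addrACA -scalerDl mulrDl.
Qed.

Lemma norm_coord_next : `|lam idx1 - theta| * cmod (cdot (x idx1) w) = `|C + xi * cp|.
Proof.
rewrite -!cmod_real -cmodM -(coord_shifted A_herm Alx) residual_expansion.
rewrite !(cdotDr, cdotZr) (decomp_e_orth dec) (decomp_f_orth dec) x_on eqxx.
by rewrite !mulr0 addr0 addr0 mulr1 cmodM (decomp_phase dec) mulr1.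
Qed.

Lemma shifted_orth_part_next : B *m orth_part x w = t%:C *: e + (xi * sp)%:C *: f.
Proof.
rewrite mulmxBr -scalemxAr shifted_eigenvector scalerA mulrC.
rewrite -(coord_shifted A_herm Alx) residual_expansion.
rewrite !(cdotDr, cdotZr) (decomp_e_orth dec) (decomp_f_orth dec) x_on eqxx.
by rewrite !mulr0 !addr0 mulr1 scalerA addrAC subrr add0r.
Qed.

Lemma cdot_shifted_eigenvector v : cdot (x idx1) v = 0 -> cdot (B *m v) (s *: x idx1) = 0.
Proof.
move=> xv; rewrite cdotZr -cdot_conj (coord_shifted A_herm Alx) xv.
by rewrite mulr0 rmorph0 mulr0.
Qed.

Let C_ge0 : 0 <= C.
Proof. by rewrite /C (cos_acute_angle Alx) divr_ge0 ?cmod_ge0 ?cnorm_ge0. Qed.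

Let t_ge0 : 0 <= t.
Proof. exact: (sin_acute_angle_ge0 Alx). Qed.

(** This is (B u)^* d = 0 in absolute value, the residual being xi d. The cross
terms vanish because B maps the complement of x to itself. *)
Lemma residual_direction_orth :
  `|lam idx1 - theta| * (C * `|cp|) = t * sp * cmod (cdot f (B *m e)).
Proof.
have Bud0 : cdot (B *m u) d = 0.
  have := minres_residual_orth m_gt0 (step_minres step).
  rewrite (step_residual step) addrC addKr cdotZr => /eqP.
  rewrite mulf_eq0 => /orP[|/eqP//].
  by rewrite -cmod_eq0 cmod_real normr_eq0 gt_eqF // (step_xi_gt0 step).
have BuE : B *m u = (C * (lam idx1 - theta))%:C *: (s *: x idx1) + t%:C *: (B *m e).
  rewrite {1}uE mulmxDr -!scalemxAr shifted_eigenvector !scalerA rmorphM.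
  by rewrite -!mulrA (mulrC s).
have sum0 : (C * (lam idx1 - theta) * cp)%:C + (t * sp)%:C * cdot (B *m e) f = 0.
  have yz := cdot_shifted_eigenvector (decomp_e_orth dec).
  have yf : cdot (s *: x idx1) f = 0 by rewrite cdotZl (decomp_f_orth dec) mulr0.
  have yy : cdot (s *: x idx1) (s *: x idx1) = 1 by rewrite cdot_self sx1 expr1n.
  rewrite -{}Bud0 BuE dE; move: (s *: x idx1) yz yf yy => y yz yf yy.
  rewrite cdotDl !cdotDr !cdotZl !cdotZr yz yf yy !conj_realC.
  by ring.
have : cmod (C * (lam idx1 - theta) * cp)%:C = cmod ((t * sp)%:C * cdot (B *m e) f).
  by move/eqP: sum0; rewrite addr_eq0 => /eqP ->; rewrite /cmod normrN.
rewrite cmodM -[cdot f _]cdot_conj cmod_conj !cmod_real !normrM.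
by rewrite (ger0_norm C_ge0) (ger0_norm t_ge0) (ger0_norm sin_angle_d_ge0) => <-; ring.
Qed.

Hypothesis good : good_approximation lam theta.

Let G : R := `|lam idx2 - lam idx1|.
Let M : R := `|lam idx2 - theta|.

Lemma gap_gt0 : 0 < G.
Proof.
have := approx_half good; rewrite distrC [X in _ < _ * X]distrC -/G.
by have := normr_ge0 (theta - lam idx1); lra.
Qed.

Lemma betaMgap : b * G = lam_max lam - lam_min lam.
Proof. by rewrite /b /beta divfK // gt_eqF // gap_gt0. Qed.

Lemma beta_ge1 : 1 <= b.
Proof.
rewrite -(ler_pM2r gap_gt0) mul1r betaMgap ler_norml.
have /andP[? ?] := lam_in_range lam idx1; have /andP[? ?] := lam_in_range lam idx2.
by apply/andP; split; lra.
Qed.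

(** The weight 1 - |x^* u|^2 in the error of the Rayleigh quotient is
sin^2 phi. *)
Lemma rayleigh_quadratic : `|lam idx1 - theta| <= b * G * t ^+ 2.
Proof.
apply: le_trans (rayleigh_error A_herm Alx u1) _.
by rewrite betaMgap /t sin2cos2 (cos_acute_angle Alx) u1 divr1.
Qed.

Lemma gap_le_shifted_gap : G - `|lam idx1 - theta| <= M.
Proof.
rewrite lerBlDr (le_trans _ (ler_normB _ _)) //.
by rewrite opprB addrA subrK.
Qed.

Lemma shifted_gap_le v : cdot (x idx1) v = 0 -> M * cnorm v <= cnorm (B *m v).
Proof.
apply: (shifted_lower_bound A_herm Alx) => [|i i1]; first exact: normr_ge0.
apply: (approx_le good); rewrite lt0n /=.
by move: i1; rewrite -val_eqE /= -lt0n.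
Qed.

(** The two smallness conditions are explicit, so that the same bound serves when
1 - xi has a fixed lower bound and when it tends to zero with sin phi. *)
Lemma rqi_step_cubic :
  is_angle_f_Ae A u e f varphi -> 0 < c -> c <= `|cos varphi| ->
  0 < t -> b * t ^+ 2 <= 1 / 4 -> 3 * t ^+ 2 <= 1 - xi ->
  acute_tan_le (acute_angle u' (x idx1))
    (2 * b * (c + 2 * xi * b) / ((1 - xi) * c) * t ^+ 3).
Proof.
move=> fAe c0 c_le t0 bt txi.
have w0 : 0 < cnorm w by rewrite lt0r cnorm_eq0 (step_neq0 step) cnorm_ge0.
rewrite (step_next step) acute_angle_scale ?invr_gt0 //.
have b0 : 0 <= b by apply: le_trans beta_ge1.
have xi0 := step_xi_gt0 step.
have C1 : C <= 1 by exact: cos_le1.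
have C2 : C ^+ 2 + t ^+ 2 = 1 by exact: cos2Dsin2.
have Ct : 1 - t ^+ 2 <= C by rewrite -C2 addrK expr2 ler_piMr.
have cp1 : `|cp| <= 1 by rewrite ler_norml cos_le1 cos_geN1.
have sp0 : 0 <= sp := sin_angle_d_ge0.
have MS : M * cnorm (orth_part x w) <= t + xi * sp.
  apply: le_trans (shifted_gap_le (cdot_orth_part Alx w)) _.
  rewrite shifted_orth_part_next.
  apply: cnorm_unit_comb_le (decomp_e_unit dec) (decomp_f_unit dec) t_ge0 _.
  exact: mulr_ge0 (ltW xi0) sp0.
have fBe : M * c <= cmod (cdot f (B *m e)).
  have := shifted_gap_le (decomp_e_orth dec); rewrite (decomp_e_unit dec) mulr1.
  by rewrite fAe => MBe; apply: ler_pM => //; [exact: normr_ge0 | exact: ltW].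
have spc : t * sp * (M * c) <= `|lam idx1 - theta|.
  apply: le_trans (_ : t * sp * cmod (cdot f (B *m e)) <= _).
    by rewrite ler_wpM2l ?mulr_ge0.
  rewrite -residual_direction_orth -[leRHS]mulr1 ler_wpM2l //.
  by rewrite mulr_ile1.
have [a0 Sa] := tangent_estimate b0 c0 xi0 t0 gap_gt0 sp0 (cnorm_ge0 _)
  (normr_ge0 _) C1 Ct cp1 rayleigh_quadratic gap_le_shifted_gap MS norm_coord_next
  spc bt txi.
by apply: (acute_tan_le_orth Alx) => //; rewrite -cmod_eq0 gt_eqF.
Qed.

(** Every power A^i u is then a multiple of x, so the Krylov space is the line
spanned by x whatever its order. *)
Lemma rqi_step_of_eigenvector : t = 0 -> acute_tan_le (acute_angle u' (x idx1)) 0.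
Proof.
move=> t0.
have Au i : A ^+ i *m u \in <[x idx1]>%VS.
  rewrite uE t0 scale0r addr0 -!scalemxAr !memvZ //.
  elim: i => [|i IH]; first by rewrite expr0 mul1mx memv_line.
  rewrite exprSr -mulmxA (eigen_pair Alx) -scalemxAr memvZ //.
have /vlineP[a wE] : w \in <[x idx1]>%VS.
  apply: subvP (step_minres step).1; apply/span_subvP => v /mapP[i _ ->].
  exact: Au.
have w0 : 0 < cnorm w by rewrite lt0r cnorm_eq0 (step_neq0 step) cnorm_ge0.
rewrite (step_next step) acute_angle_scale ?invr_gt0 //.
have xw : cdot (x idx1) w = a by rewrite wE cdotZr x_on eqxx mulr1.
apply: (acute_tan_le_orth Alx).
  rewrite xw; apply: contraTneq w0 => a0.
  by rewrite wE a0 scale0r lt0r cnorm_eq0 eqxx.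
by rewrite /orth_part xw wE subrr mul0r (eqP (_ : cnorm 0 == 0)) ?cnorm_eq0.
Qed.

End OneStep.

(** * Quadratic and linear regimes *)

(** Since c <= 1 <= b, the factor 2 b (c + 2 xi b) is at most 6 b^2, the constant
in the assumption on xi, which is used with q = t and q = t^2. The first
conclusion yields 3 t^2 <= 1 - xi, the condition under which the cubic bound
holds. *)
Lemma cubic_bound_le (R : realFieldType) (b c xi t q k : R) :
  1 <= b -> 0 < c -> c <= 1 -> 0 < xi -> 0 < t -> 0 < q -> 0 < k ->
  xi <= 1 - 6 * b ^+ 2 * q / (k * c) ->
  6 * q <= k * (1 - xi) /\
  2 * b * (c + 2 * xi * b) / ((1 - xi) * c) * t ^+ 3 <= k * (t ^+ 3 / q).
Proof.
move=> b1 c0 c1 xi0 t0 q0 k0 xile.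
have b0 : 0 < b by lra.
have gap : 6 * b ^+ 2 * q <= (1 - xi) * (k * c).
  by rewrite -ler_pdivrMr ?mulr_gt0 //; lra.
have xi1 : 0 < 1 - xi.
  rewrite -(pmulr_lgt0 _ (mulr_gt0 k0 c0)) (lt_le_trans _ gap) //.
  by rewrite !mulr_gt0 ?exprn_gt0.
have b2 : 1 <= b ^+ 2 by rewrite exprn_ege1.
split.
  have : 6 * q <= 6 * b ^+ 2 * q by nra.
  have : (1 - xi) * (k * c) <= (1 - xi) * k.
    by rewrite ler_pM2l // ler_piMr // ltW.
  lra.
have -> : 2 * b * (c + 2 * xi * b) / ((1 - xi) * c) * t ^+ 3 =
    (2 * b * (c + 2 * xi * b) * q) / ((1 - xi) * c) * (t ^+ 3 / q).
  by field; rewrite ?lt0r_neq0.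
rewrite ler_wpM2r ?divr_ge0 ?exprn_ge0 ?(ltW t0) ?(ltW q0) //.
rewrite ler_pdivrMr ?mulr_gt0 // (le_trans _ (_ : 6 * b ^+ 2 * q <= _)) //; last by lra.
rewrite ler_pM2r //.
have : c + 2 * xi * b <= 3 * b by nra.
nra.
Qed.

Lemma acute_tan_le_trans (R : realType) (phi b b' : R) :
  b <= b' -> acute_tan_le phi b -> acute_tan_le phi b'.
Proof. by move=> bb [? tb]; split=> //; apply: le_trans bb. Qed.

Theorem theorem5 (R : realType) (n : nat) (A : 'M[R[i]]_n.+2)
    (lam : 'I_n.+2 -> R) (x : 'I_n.+2 -> 'cV[R[i]]_n.+2)
    (varphi0 xi0 eta zeta : R)
    (A_herm : A \is hermsymmx)
    (Alx : orthonormal_eigensystem A lam x)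
    (varphi0_gt0 : 0 < `|cos varphi0|)
    (xi0_lt1 : xi0 < 1)
    (eta_gt0 : 0 < eta)
    (zeta_gt0 : 0 < zeta) (zeta_lt1 : zeta < 1) :
  exists2 eps : R, 0 < eps &
  forall (m : nat) (K : pred nat)
    (u w d e f : nat -> 'cV[R[i]]_n.+2) (s : nat -> R[i])
    (xi varphi : nat -> R),
  (1 < m)%N ->
  inexact_rqi_minres m A lam x K u w d e f s xi varphi ->
  (forall k, K k -> `|cos varphi0| <= `|cos (varphi k)|) ->
  let phi k := acute_angle (u k) (x idx1) in
  let b := beta lam in
  let c := `|cos varphi0| in
  forall k, K k -> sin (phi k) < eps ->
  [/\ xi k <= xi0 ->
      acute_tan_le (phi k.+1)
        (2 * b * (c + 2 * xi k * b) / ((1 - xi k) * c) * sin (phi k) ^+ 3),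
      xi k <= 1 - 6 * b ^+ 2 * sin (phi k) / (eta * c) ->
      acute_tan_le (phi k.+1) (eta * sin (phi k) ^+ 2)
    & 1 - 6 * b ^+ 2 * sin (phi k) / (eta * c) < xi k ->
      xi k <= 1 - 6 * b ^+ 2 * sin (phi k) ^+ 2 / (zeta * c) ->
      acute_tan_le (phi k.+1) (zeta * sin (phi k))].
Proof.
pose D := `|beta lam| + 1.
have D0 : 0 < D by rewrite ltr_wpDl.
(* In this order: beta sin^2 phi <= 1 / 4, then 3 sin^2 phi <= 1 - xi in the
   cubic case, and 3 sin^2 phi <= 1 - xi in the quadratic case. *)
exists (Num.min (4 * D)^-1 (Num.min ((1 - xi0) / 3) eta^-1)).
  by rewrite !lt_min !(invr_gt0, mulr_gt0, divr_gt0) ?subr_gt0.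
move=> m K u w d e f s xi varphi m1 run cos_lb phi b c k Kk.
rewrite !lt_min => /and3P[tD txi0 teta].
have m0 : (0 < m)%N := ltnW m1.
have step := run_step run Kk; have good := run_approx run Kk.
have dec := run_decomp run Kk; have fAe := run_varphi run Kk.
have xi_gt0 := step_xi_gt0 step.
have b1 : 1 <= b := beta_ge1 good.
have c1 : c <= 1 by rewrite ler_norml cos_le1 cos_geN1.
have [t0|t0] := eqVneq (sin (phi k)) 0.
  have tan0 := rqi_step_of_eigenvector Alx step dec t0.
  rewrite t0 !expr0n /= !mulr0.
  by split=> *; apply: acute_tan_le_trans tan0.
pose t := sin (phi k); rewrite -/t in tD txi0 teta t0 *.
have {}t0 : 0 < t by rewrite lt0r t0 (sin_acute_angle_ge0 Alx).
have cubic : b * t ^+ 2 <= 1 / 4 -> 3 * t ^+ 2 <= 1 - xi k ->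
    acute_tan_le (phi k.+1)
      (2 * b * (c + 2 * xi k * b) / ((1 - xi k) * c) * t ^+ 3).
  exact: (rqi_step_cubic A_herm Alx m0 step dec good fAe varphi0_gt0 (cos_lb k Kk)).
have t1 : t <= 1 := sin_le1 _.
have t2 : t ^+ 2 <= t by rewrite expr2 ler_piMr // ltW.
have bt : b * t ^+ 2 <= 1 / 4.
  have bD : b <= D by rewrite (le_trans (ler_norm _)) // lerDl.
  have Dt : D * t <= 1 / 4.
    by have := ltW tD; rewrite -[_^-1]mul1r ler_pdivlMr ?mulr_gt0 //; lra.
  by apply: le_trans Dt; rewrite ler_pM ?sqr_ge0 //; apply: le_trans b1.
have {}cubic := cubic bt.
split.
- by move=> xile; apply: cubic; lra.
- move=> /(cubic_bound_le b1 varphi0_gt0 c1 xi_gt0 t0 t0 eta_gt0)[gap Tle].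
  apply: acute_tan_le_trans (cubic _).
    by apply: le_trans Tle _; rewrite exprSr mulfK // lt0r_neq0.
  have := ltW teta; rewrite -[_^-1]mul1r ler_pdivlMr // => teta1.
  nra.
- move=> _ /(cubic_bound_le b1 varphi0_gt0 c1 xi_gt0 t0 (exprn_gt0 2 t0) zeta_gt0)[gap Tle].
  apply: acute_tan_le_trans (cubic _).
    by apply: le_trans Tle _; rewrite exprS mulfK // lt0r_neq0 ?exprn_gt0.
  nra.
Qed.
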